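(* Let $R$ be an associative ring with identity, let $\mathcal{X}$ be a precovering class of left $R$-modules closed under isomorphisms, finite direct sums and direct summands, and let $0\to M\xrightarrow{\alpha}X\to M'\to 0$ be a short exact sequence of left $R$-modules with $X\in\mathcal{X}$. Then ${M'}^{\perp}\subseteq\mathcal{X}^{-1}(M)$. Moreover, if $\alpha:M\to X$ is an $\mathcal{X}$-preenvelope, then $\mathcal{X}^{-1}(M)\cap X^{\perp}\subseteq{M'}^{\perp}$.
   Context: Modules are unital left $R$-modules. For a module $L$, $L^{\perp}=\{N : \mathrm{Ext}^1(L,N)=0\}$. For a class $\mathcal{X}$ of modules, an $\mathcal{X}$-precover of $N$ is a morphism $g:X\to N$ with $X\in\mathcal{X}$ such that $\mathrm{Hom}(X',X)\to\mathrm{Hom}(X',N)$ is surjective for every $X'\in\mathcal{X}$; dually, an $\mathcal{X}$-preenvelope of $M$ is a morphism $\alpha:M\to X$ with $X\in\mathcal{X}$ such that $\mathrm{Hom}(X,X')\to\mathrm{Hom}(M,X')$ is surjective for every $X'\in\mathcal{X}$. $\mathcal{X}$ is precovering if every module has an $\mathcal{X}$-precover. The $\mathcal{X}$-precover completing domain $\mathcal{X}^{-1}(M)$ of a module $M$ is the class of all modules $N$ such that for every morphism $f:M\to N$ and every $\mathcal{X}$-precover $g:X\to N$ there is a morphism $h:M\to X$ with $gh=f$. *)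

(* Defs.v *)
From HB Require Import structures.
From mathcomp Require Import all_boot all_algebra.

Set Implicit Arguments.
Unset Strict Implicit.
Unset Printing Implicit Defensive.

Import GRing.Theory.
Local Open Scope ring_scope.

Definition short_exact (R : pzRingType) (A B C : lmodType R)
    (i : {linear A -> B}) (p : {linear B -> C}) : Prop :=
  [/\ injective i, (forall c, exists b, p b = c)
    & forall b, p b = 0 <-> exists a, i a = b].

Definition isomorphic (R : pzRingType) (A B : lmodType R) : Prop :=
  exists f : {linear A -> B}, bijective f.

(* [R : pzRingType] is an arbitrary associative ring with identity, the zero
   ring being allowed.

   Ext^1(L, N) is the Yoneda Ext: the collection of equivalence classes of
   extensions 0 -> N -> E -> L -> 0, whose zero is the class of the split
   extension 0 -> N -> N (+) L -> L -> 0. *)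
Section Ext1.
Variables (R : pzRingType) (L N : lmodType R).

Record extension := Extension {
  ext_mod :> lmodType R;
  ext_in : {linear N -> ext_mod};
  ext_out : {linear ext_mod -> L};
  ext_exact : short_exact ext_in ext_out }.

Definition ext_equiv (E E' : extension) : Prop :=
  exists f : {linear ext_mod E -> ext_mod E'},
    [/\ bijective f, f \o ext_in E =1 ext_in E' & ext_out E' \o f =1 ext_out E].

Lemma ext_equiv_refl E : ext_equiv E E.
Proof. by exists idfun; split=> //; exists id. Qed.

Lemma ext_equiv_trans E F G : ext_equiv E F -> ext_equiv F G -> ext_equiv E G.
Proof.
move=> [f [bf fi fo]] [g [bg gi go]]; exists (g \o f); split.
- exact: bij_comp.
- by move=> x; rewrite -gi /= -fi.
- by move=> x; rewrite -fo /= -go.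
Qed.

Lemma ext_equiv_sym E F : ext_equiv E F -> ext_equiv F E.
Proof.
move=> [f [[g fK gK] fi fo]].
have lg : linear g.
  by move=> a x y; apply: (can_inj fK); rewrite gK linearP !gK.
pose gL := GRing.isLinear.Build _ _ _ _ g lg.
pose gl : {linear F -> E} := HB.pack g gL.
exists gl; split.
- by exists f.
- by move=> x /=; rewrite -fi /= fK.
- by move=> x /=; rewrite -fo /= gK.
Qed.

Definition split_in (n : N) : (N * L)%type := (n, 0).

Fact split_in_linear : linear split_in.
Proof.
move=> a x y; rewrite /split_in.
by apply/eqP; rewrite xpair_eqE /= scaler0 addr0 !eqxx.
Qed.

HB.instance Definition _ :=
  GRing.isLinear.Build R N (N * L)%type *:%R split_in split_in_linear.

Fact split_exact :
  short_exact (split_in : {linear N -> (N * L)%type})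
              (snd : {linear (N * L)%type -> L}).
Proof.
split=> [x y [] // | c | [n l]]; first by exists (0, c).
by split=> /= [-> | [a [_ <-]] //]; exists n.
Qed.

Definition split_extension : extension := Extension split_exact.

Definition Ext1 : Type :=
  {C : extension -> Prop | exists E, C = ext_equiv E}.

Definition Ext1_class (E : extension) : Ext1 :=
  exist _ (ext_equiv E) (ex_intro _ E erefl).

Definition Ext1_zero : Ext1 := Ext1_class split_extension.

End Ext1.

(* [perp L N] says that N belongs to the class L^⊥. *)
Definition perp (R : pzRingType) (L N : lmodType R) : Prop :=
  forall c : Ext1 L N, c = Ext1_zero L N.

Section ModuleClasses.
Variables (R : pzRingType) (XX : lmodType R -> Prop).

Definition is_precover (N X : lmodType R) (g : {linear X -> N}) : Prop :=
  XX X /\ forall X' : lmodType R, XX X' ->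
    forall f : {linear X' -> N}, exists h : {linear X' -> X}, g \o h =1 f.

Definition is_preenvelope (M X : lmodType R) (a : {linear M -> X}) : Prop :=
  XX X /\ forall X' : lmodType R, XX X' ->
    forall f : {linear M -> X'}, exists h : {linear X -> X'}, h \o a =1 f.

Definition precovering : Prop :=
  forall N : lmodType R, exists (X : lmodType R) (g : {linear X -> N}),
    is_precover g.

(* [precover_completing_domain M N] says that N belongs to XX^{-1}(M). *)
Definition precover_completing_domain (M N : lmodType R) : Prop :=
  forall (f : {linear M -> N}) (X : lmodType R) (g : {linear X -> N}),
    is_precover g -> exists h : {linear M -> X}, g \o h =1 f.

Definition closed_under_isomorphisms : Prop :=
  forall A B : lmodType R, isomorphic A B -> XX A -> XX B.

(* S is a direct sum of the A i, presented by the biproduct identities between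
   the injections and the projections; for n = 0 it forces S = 0. *)
Definition is_direct_sum (n : nat) (A : 'I_n -> lmodType R)
    (S : lmodType R) : Prop :=
  exists (inj : forall i, {linear A i -> S})
         (proj : forall i, {linear S -> A i}),
    [/\ (forall i x, proj i (inj i x) = x),
        (forall i j x, i != j -> proj j (inj i x) = 0)
      & (forall s, s = \sum_(i < n) inj i (proj i s))].

Definition closed_under_finite_direct_sums : Prop :=
  forall (n : nat) (A : 'I_n -> lmodType R) (S : lmodType R),
    is_direct_sum A S -> (forall i, XX (A i)) -> XX S.

Definition closed_under_direct_summands : Prop :=
  forall A B C : lmodType R, isomorphic B (A * C)%type -> XX B -> XX A.

End ModuleClasses.

(* Main.v *)
Require Import Defs.
From HB Require Import structures.
From mathcomp Require Import all_boot all_algebra.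
From mathcomp Require Import boolp.

(** Both halves reduce to extending maps [M -> N] along [alpha].  If
    Ext^1(M', N) = 0, pushing the sequence out along [f : M -> N] gives a split
    extension of M' by N, so [f] extends to X, and the extension lifts through
    any precover of N because X is in the class.  Conversely, [f] lifts to a
    precover of N, the lift extends to X because [alpha] is a preenvelope, so
    every [f] extends to X.  Given an extension of M' by N, pulling it back to X
    and using Ext^1(X, N) = 0 lifts [beta] to E; correcting the lift by an
    extension to X of its restriction [M -> N] makes it vanish on M, hence
    descend to a section over M'. *)

Set Implicit Arguments.
Unset Strict Implicit.
Unset Printing Implicit Defensive.

Import GRing.Theory.
Local Open Scope ring_scope.
Local Open Scope quotient_scope.

Lemma inj_surj_bijective (A B : choiceType) (f : A -> B) :
  injective f -> (forall b, exists a, f a = b) -> bijective f.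
Proof.
move=> f_inj f_surj.
have exf b : exists a, f a == b by have [a <-] := f_surj b; exists a.
pose g b := xchoose (exf b).
have fgK : cancel g f by move=> b; apply/eqP/(xchooseP (exf b)).
by exists g => // a; apply: f_inj; rewrite fgK.
Qed.

(** * Factoring linear maps through injections and surjections *)

Section LinearMaps.
Variable R : pzRingType.

Lemma linear_inj (A B : lmodType R) (f : {linear A -> B}) :
  (forall a, f a = 0 -> a = 0) -> injective f.
Proof.
move=> f0 x y fxy; apply/eqP; rewrite -subr_eq0; apply/eqP/f0.
by rewrite linearB fxy subrr.
Qed.

(** Preimages under [i] are unique, so choosing them pointwise already gives a linear map. *)
Lemma factor_through_mono (A B C : lmodType R)
    (i : {linear A -> B}) (h : {linear C -> B}) :
  injective i -> (forall c, exists a, i a = h c) ->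
  exists k : {linear C -> A}, i \o k =1 h.
Proof.
move=> i_inj h_im.
have exi c : exists a, i a == h c by have [a <-] := h_im c; exists a.
pose k c := xchoose (exi c).
have ikE c : i (k c) = h c by apply/eqP/(xchooseP (exi c)).
have k_lin : linear k.
  by move=> a x y; apply: i_inj; rewrite ikE !linearP /= !ikE.
pose kl : {linear C -> A} := HB.pack k (GRing.isLinear.Build _ _ _ _ k k_lin).
by exists kl.
Qed.

(** Compose [h] with a set-theoretic section of [p]. The section need not be linear, but the kernel
    condition makes the composite independent of its choice, hence linear. *)
Lemma factor_through_epi (B C D : lmodType R)
    (p : {linear B -> C}) (h : {linear B -> D}) :
  (forall c, exists b, p b = c) -> (forall b, p b = 0 -> h b = 0) ->
  exists k : {linear C -> D}, k \o p =1 h.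
Proof.
move=> p_surj h_ker.
have exp c : exists b, p b == c by have [b <-] := p_surj c; exists b.
pose s c := xchoose (exp c).
have psK c : p (s c) = c by apply/eqP/(xchooseP (exp c)).
have hE b b' : p b = p b' -> h b = h b'.
  move=> pb; apply/eqP; rewrite -subr_eq0 -linearB; apply/eqP/h_ker.
  by rewrite linearB pb subrr.
have k_lin : linear (h \o s).
  by move=> a x y /=; rewrite -linearP; apply: hE; rewrite linearP !psK.
pose k : {linear C -> D} :=
  HB.pack (h \o s) (GRing.isLinear.Build _ _ _ _ (h \o s) k_lin).
by exists k => b /=; apply: hE; rewrite psK.
Qed.

End LinearMaps.

(** * Quotient of a module by a submodule *)

Section QuotientModule.
Variables (R : pzRingType) (V : lmodType R) (S : {pred V}).
Hypothesis S_closed : submod_closed S.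

(** Seen as an additive subgroup, [S] already has a quotient group; only the scalar action remains
    to be added. *)
Let zS : zmodClosed V :=
  HB.pack S (GRing.isZmodClosed.Build V S (GRing.submod_closedB S_closed)).

Definition quotmod := Quotient.quot zS.
HB.instance Definition _ := GRing.Zmodule.on quotmod.

Definition quotmod_pi (v : V) : quotmod := \pi_(Quotient.quot zS) v.

Lemma quotmod_piP u v : quotmod_pi u = quotmod_pi v <-> u - v \in S.
Proof.
have <- : (u - v \in zS) = (u - v \in S) by [].
by rewrite Quotient.idealrBE; split=> [/eqP | /eqP].
Qed.

Lemma quotmod_pi_surj (x : quotmod) : exists v, quotmod_pi v = x.
Proof. by exists (repr (x : Quotient.quot zS)); rewrite /quotmod_pi reprK. Qed.

Lemma quotmod_piD : {morph quotmod_pi : u v / u + v}.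
Proof. exact: (raddfD (\pi_(Quotient.quot zS))). Qed.

Definition quotmod_scale (a : R) (x : quotmod) : quotmod :=
  quotmod_pi (a *: repr (x : Quotient.quot zS)).

(** Stability of [S] under scaling makes the action independent of the representative, so the module
    laws descend from [V]. *)
Lemma quotmod_piZ a v : quotmod_scale a (quotmod_pi v) = quotmod_pi (a *: v).
Proof.
apply/quotmod_piP; rewrite -scalerBr.
have [_ SZ] := GRing.submod_closed_semi S_closed; apply: SZ.
by apply/quotmod_piP; rewrite {1}/quotmod_pi reprK.
Qed.

Lemma quotmod_scalerA a b x :
  quotmod_scale a (quotmod_scale b x) = quotmod_scale (a * b) x.
Proof. by have [v <-] := quotmod_pi_surj x; rewrite !quotmod_piZ scalerA. Qed.

Lemma quotmod_scale1r : left_id 1 quotmod_scale.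
Proof.
by move=> x; have [v <-] := quotmod_pi_surj x; rewrite quotmod_piZ scale1r.
Qed.

Lemma quotmod_scalerDr : right_distributive quotmod_scale +%R.
Proof.
move=> a x y; have [u <-] := quotmod_pi_surj x.
have [v <-] := quotmod_pi_surj y.
by rewrite -quotmod_piD !quotmod_piZ -quotmod_piD scalerDr.
Qed.

Lemma quotmod_scalerDl x : {morph quotmod_scale^~ x : a b / a + b}.
Proof.
move=> a b; have [v <-] := quotmod_pi_surj x.
by rewrite !quotmod_piZ -quotmod_piD scalerDl.
Qed.

HB.instance Definition _ := GRing.Zmodule_isLmodule.Build R quotmod
  quotmod_scalerA quotmod_scale1r quotmod_scalerDr quotmod_scalerDl.

Fact quotmod_pi_linear : linear quotmod_pi.
Proof. by move=> a u v; rewrite quotmod_piD -quotmod_piZ. Qed.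

HB.instance Definition _ :=
  GRing.isLinear.Build R V quotmod *:%R quotmod_pi quotmod_pi_linear.

End QuotientModule.

(** * Pullback of two linear maps *)

Section Pullback.
Variables (R : pzRingType) (A B C : lmodType R).
Variables (p : {linear A -> C}) (q : {linear B -> C}).

Definition pullback_pred : {pred A * B} := fun x => p x.1 == q x.2.

(** Being a subtype of [A * B], it inherits its module structure as a submodule, with [val] as the
    inclusion. *)
Record pullback := Pullback { pb_val :> A * B; _ : pb_val \in pullback_pred }.

HB.instance Definition _ := [isSub for pb_val].
HB.instance Definition _ := [Choice of pullback by <:].

Fact pullback_closed : subsemimod_closed pullback_pred.
Proof.
split; first split; rewrite ?unfold_in /= ?linear0 //.
  by move=> x y /eqP xE /eqP yE; rewrite unfold_in /= !linearD xE yE.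
by move=> a x /eqP xE; rewrite unfold_in /= !linearZ /= xE.
Qed.

HB.instance Definition _ := GRing.SubChoice_isSubLmodule.Build
  R (A * B)%type pullback_pred pullback pullback_closed.

Definition pb_fst (x : pullback) : A := (val x).1.
Definition pb_snd (x : pullback) : B := (val x).2.

Fact pb_fst_linear : linear pb_fst.
Proof. by move=> a x y; rewrite /pb_fst linearP. Qed.
Fact pb_snd_linear : linear pb_snd.
Proof. by move=> a x y; rewrite /pb_snd linearP. Qed.

HB.instance Definition _ :=
  GRing.isLinear.Build R pullback A *:%R pb_fst pb_fst_linear.
HB.instance Definition _ :=
  GRing.isLinear.Build R pullback B *:%R pb_snd pb_snd_linear.

Lemma pullbackE x : p (pb_fst x) = q (pb_snd x).
Proof. by case: x => x xP; apply/eqP. Qed.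

Lemma pullback_ex a b : p a = q b -> exists x, pb_fst x = a /\ pb_snd x = b.
Proof.
move=> ab; have abP : (a, b) \in pullback_pred by rewrite unfold_in /= ab.
by exists (Pullback abP).
Qed.

Lemma pullback_eq x y : pb_fst x = pb_fst y -> pb_snd x = pb_snd y -> x = y.
Proof.
move=> h1 h2; apply: val_inj; rewrite [LHS]surjective_pairing.
by rewrite [RHS]surjective_pairing; congr pair.
Qed.

End Pullback.

(** * Vanishing of Ext, splittings, extension and lifting of maps *)

Section Splitting.
Variable R : pzRingType.

Lemma perp_ext_equiv (L N : lmodType R) (E : extension L N) :
  perp L N -> ext_equiv E (split_extension L N).
Proof. by move=> /(_ (Ext1_class E)) [] ->; exact: ext_equiv_refl. Qed.

Lemma perp_retraction (L N E : lmodType R)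
    (i : {linear N -> E}) (p : {linear E -> L}) :
  perp L N -> short_exact i p -> exists r : {linear E -> N}, cancel i r.
Proof.
move=> LN ip; have [f [_ fi _]] := perp_ext_equiv (Extension ip) LN.
by exists (fst \o f) => n; have /= -> := fi n.
Qed.

(** The map [id - i r] kills the image of [i], which is the kernel of [p], so it descends to [L]; as
    [p i = 0], the descended map is a section. *)
Lemma retraction_section (L N E : lmodType R)
    (i : {linear N -> E}) (p : {linear E -> L}) (r : {linear E -> N}) :
  short_exact i p -> cancel i r -> exists s : {linear L -> E}, cancel s p.
Proof.
move=> [_ p_surj p_ker] irK.
have pi0 n : p (i n) = 0 by apply/p_ker; exists n.
have ker0 e : p e = 0 -> (idfun \- (i \o r)) e = 0.
  by move=> /p_ker [n <-] /=; rewrite irK subrr.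
have [s sE] := factor_through_epi p_surj ker0.
exists s => l; have [e <-] := p_surj l.
by have /= -> := sE e; rewrite linearB pi0 subr0.
Qed.

(** A section [s] turns [(n, l) |-> i n + s l] into an equivalence from the split extension, and
    equivalent extensions have the same class. *)
Lemma section_perp (L N : lmodType R) :
  (forall (E : lmodType R) (i : {linear N -> E}) (p : {linear E -> L}),
     short_exact i p -> exists s : {linear L -> E}, cancel s p) ->
  perp L N.
Proof.
move=> splits [C CE].
(* An element of [Ext1] pairs a class with a proof; by proof irrelevance only the class matters. *)
suff zeroE : C = ext_equiv (split_extension L N).
  rewrite /Ext1_zero /Ext1_class; move: CE; rewrite zeroE => CE.
  by congr exist; apply: Prop_irrelevance.
case: CE => E ->; have [s sK] := splits _ _ _ (ext_exact E).
have [i_inj p_surj p_ker] := ext_exact E.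
set i := ext_in E in i_inj p_ker *; set p := ext_out E in sK p_surj p_ker *.
have pi0 n : p (i n) = 0 by apply/p_ker; exists n.
pose f : {linear (N * L)%type -> ext_mod E} := (i \o fst) \+ (s \o snd).
have splitE : ext_equiv (split_extension L N) E.
  exists f; split.
  - apply: inj_surj_bijective => [|e].
      apply: linear_inj => -[n l] /= fnl.
      have l0 : l = 0.
        by have := congr1 p fnl; rewrite linearD pi0 sK add0r linear0.
      by move: fnl; rewrite l0 linear0 addr0 -(linear0 i) => /i_inj ->.
    have [n nE] : exists n, i n = e - s (p e).
      by apply/p_ker; rewrite linearB sK subrr.
    by exists (n, p e); rewrite /= nE subrK.
  - by move=> n /=; rewrite linear0 addr0.
  - by move=> [n l] /=; rewrite linearD pi0 sK add0r.
apply: funext => F; apply: propext; split; apply: ext_equiv_trans => //.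
exact: ext_equiv_sym.
Qed.

(** The pushout of [i] along [f] is an extension of [C] by [N]. A retraction of it onto [N],
    composed with the canonical map from [B], extends [f]. *)
Lemma perp_extends (A B C N : lmodType R)
    (i : {linear A -> B}) (p : {linear B -> C}) (f : {linear A -> N}) :
  short_exact i p -> perp C N -> exists g : {linear B -> N}, g \o i =1 f.
Proof.
move=> [i_inj p_surj p_ker] CN.
have pi0 a : p (i a) = 0 by apply/p_ker; exists a.
(* Dividing by [S] identifies [(f a, 0)] with [(0, i a)]. *)
pose S : {pred N * B} := fun x => `[< exists a, x = (f a, - i a) >].
have S_closed : submod_closed S.
  split; first by apply/asboolP; exists 0; rewrite !linear0.
  move=> c _ _ /asboolP[a ->] /asboolP[b ->]; apply/asboolP; exists (c *: a + b).
  by rewrite !linearP.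
pose P : lmodType R := quotmod S_closed.
pose pi : {linear (N * B)%type -> P} := quotmod_pi S_closed.
have pi_surj x : exists v, pi v = x := quotmod_pi_surj x.
have pi_eq u v : pi u = pi v <-> exists a, u - v = (f a, - i a).
  by split=> [/quotmod_piP/asboolP | /asboolP/(quotmod_piP S_closed)].
have pi_eq0 v : pi v = 0 <-> exists a, v = (f a, - i a).
  by rewrite -(linear0 pi) pi_eq subr0.
have inr_lin : linear (fun b : B => (0, b) : N * B).
  by move=> c x y; apply/eqP; rewrite xpair_eqE /= scaler0 addr0 !eqxx.
pose inr : {linear B -> (N * B)%type} :=
  HB.pack (fun b : B => (0, b) : N * B)
    (GRing.isLinear.Build R B (N * B)%type *:%R _ inr_lin).
pose j : {linear N -> P} := pi \o @split_in R B N.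
have ker_pi v : pi v = 0 -> (p \o snd) v = 0.
  by move=> /pi_eq0[a ->] /=; rewrite linearN pi0 oppr0.
have [q qE] := factor_through_epi pi_surj ker_pi.
have jq : short_exact j q.
  split.
  - apply: linear_inj => n /pi_eq0[a [-> /esym/eqP]].
    by rewrite oppr_eq0 -(linear0 i) => /eqP/i_inj ->; rewrite linear0.
  - move=> c; have [b <-] := p_surj c; exists (pi (0, b)).
    exact: (qE (0, b)).
  - move=> x; have [[n b] <-] := pi_surj x; have /= -> := qE (n, b); split.
      (* Modulo [S], the pair [(n, i a)] equals [(n + f a, 0)]. *)
      move=> /p_ker[a <-]; exists (n + f a); apply/pi_eq; exists a.
      by apply/eqP; rewrite xpair_eqE /= addrC addKr sub0r !eqxx.
    move=> [n' /esym/pi_eq[a [_]]].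
    by rewrite subr0 => ->; rewrite linearN pi0 oppr0.
have [r rK] := perp_retraction CN jq.
exists (r \o (pi \o inr)) => a /=; rewrite -[RHS]rK; congr (r _).
apply/esym/pi_eq; exists a.
by apply/eqP; rewrite xpair_eqE /= subr0 sub0r !eqxx.
Qed.

(** Pulling the extension back along [g] gives an extension of [X] by [N]. It splits, and a section
    followed by the projection to [E] lifts [g]. *)
Lemma perp_lifts (L N E X : lmodType R)
    (i : {linear N -> E}) (p : {linear E -> L}) (g : {linear X -> L}) :
  short_exact i p -> perp X N -> exists h : {linear X -> E}, p \o h =1 g.
Proof.
move=> [i_inj p_surj p_ker] XN.
have pi0 n : p (i n) = 0 by apply/p_ker; exists n.
pose P : lmodType R := pullback p g.
pose fstP : {linear P -> E} := @pb_fst R E X L p g.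
pose sndP : {linear P -> X} := @pb_snd R E X L p g.
have j_lin : linear (fun n : N => (i n, 0) : E * X).
  by move=> c x y; apply/eqP; rewrite xpair_eqE /= scaler0 addr0 linearP !eqxx.
pose j0 : {linear N -> (E * X)%type} :=
  HB.pack (fun n : N => (i n, 0) : E * X)
    (GRing.isLinear.Build R N (E * X)%type *:%R _ j_lin).
pose v : {linear P -> (E * X)%type} := val.
(* The pair [(i n, 0)] lies in the pullback because [p i = 0], so [j0] factors through the inclusion
   [v]. *)
have j0_im n : exists x, v x = j0 n.
  have [x [x1 x2]] : exists x : P, fstP x = i n /\ sndP x = 0.
    by apply: pullback_ex; rewrite pi0 linear0.
  by exists x; rewrite /v [LHS]surjective_pairing; congr pair.
have [j jE] := factor_through_mono (val_inj : injective v) j0_im.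
have j1 n : fstP (j n) = i n by have /(congr1 fst) := jE n.
have j2 n : sndP (j n) = 0 by have /(congr1 snd) := jE n.
have jp : short_exact j sndP.
  split.
  - by move=> x y jxy; apply: i_inj; rewrite -!j1 jxy.
  - move=> x; have [e eE] := p_surj (g x).
    by have [y [_ yE]] := pullback_ex eE; exists y.
  - move=> x; split=> [x0 | [n <-]]; last exact: j2.
    have /p_ker[n nE] : p (fstP x) = 0.
      by rewrite [LHS](pullbackE x) -[pb_snd x]/(sndP x) x0 linear0.
    by exists n; apply: pullback_eq; [rewrite [LHS]j1 | rewrite [LHS]j2 -x0].
have [r rK] := perp_retraction XN jp.
have [s sK] := retraction_section jp rK.
by exists (fstP \o s) => x; rewrite /= [LHS]pullbackE; congr (g _); exact: sK.
Qed.

Lemma extends_perp (M X M' N : lmodType R)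
    (alpha : {linear M -> X}) (beta : {linear X -> M'}) :
  short_exact alpha beta -> perp X N ->
  (forall f : {linear M -> N}, exists g : {linear X -> N}, g \o alpha =1 f) ->
  perp M' N.
Proof.
move=> [_ beta_surj beta_ker] XN extend.
have ba0 m : beta (alpha m) = 0 by apply/beta_ker; exists m.
apply: section_perp => E i p ip; have [i_inj _ p_ker] := ip.
have pi0 n : p (i n) = 0 by apply/p_ker; exists n.
have [b bE] := perp_lifts beta ip XN.
(* On [M] the lift [b] lands in the kernel of [p], a copy of [N]; this gives the map [f] to be
   extended. *)
have ba_im m : exists n, i n = (b \o alpha) m.
  by apply/p_ker; have /= -> := bE (alpha m).
have [f fE] := factor_through_mono i_inj ba_im.
have [g gE] := extend f.
(* Subtracting [i g] cancels [b] on [M] without changing the composite with [p]. *)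
have ker0 x : beta x = 0 -> (b \- (i \o g)) x = 0.
  move=> /beta_ker[m <-] /=; have /= -> := gE m.
  by have /= -> := fE m; rewrite subrr.
have [s sE] := factor_through_epi beta_surj ker0.
exists s => c; have [x <-] := beta_surj c.
by have /= -> := sE x; rewrite linearB pi0 subr0; exact: bE.
Qed.

End Splitting.

Theorem proposition2p7 (R : pzRingType) (XX : lmodType R -> Prop)
  (XX_precovering : precovering XX)
  (XX_iso : closed_under_isomorphisms XX)
  (XX_sum : closed_under_finite_direct_sums XX)
  (XX_summand : closed_under_direct_summands XX)
  (M X M' : lmodType R)
  (alpha : {linear M -> X}) (beta : {linear X -> M'})
  (exact_seq : short_exact alpha beta)
  (X_in_XX : XX X) :
  (forall N : lmodType R, perp M' N -> precover_completing_domain XX M N) /\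
  (is_preenvelope XX alpha ->
   forall N : lmodType R,
     precover_completing_domain XX M N /\ perp X N -> perp M' N).
Proof.
split=> [N M'N f Y g [_ g_lift] | [_ alpha_ext] N [MN XN]].
  have [f' f'E] := perp_extends f exact_seq M'N.
  have [h hE] := g_lift _ X_in_XX f'.
  by exists (h \o alpha) => m; rewrite -f'E; exact: hE.
apply: extends_perp exact_seq XN _ => f.
(* The completing domain only speaks about given precovers, so one of [N] has to be supplied. *)
have [Y [g g_cover]] := XX_precovering N.
have [h hE] := MN f _ _ g_cover.
have [k kE] := alpha_ext _ (proj1 g_cover) h.
by exists (g \o k) => m; rewrite -hE /= -kE.
Qed.
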